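(* Let $i\geqslant1$ and let $U,V\in\mathcal{B}([0,n],i)$ be such that $U\lessdot V$ is a covering relation, given by the $(i+1)$-dimensional face $F$ of the cyclic zonotope $Z([0,n],n+1)$. Then $$\partial\circ\Delta_i^F-(-1)^i\,\Delta_i^F\circ\partial=\Delta_{i-1}^U-\Delta_{i-1}^V .$$ That is, $\Delta_i^F$ gives a homotopy from $\Delta_{i-1}^V$ to $\Delta_{i-1}^U$.
   Context: Notation. $[0,n]=\{0,\dots,n\}$. $\binom{S}{k}$ is the set of $k$-element subsets of $S$; $|S|$ is the cardinality; $|S|_{<x}=|\{s\in S: s<x\}|$, $|S|_{>x}=|\{s\in S:s>x\}|$. Chains. $C_\bullet(\Delta^n)$ is the chain complex of free $\mathbb{Z}$-modules with basis the non-empty subsets $X\subseteq[0,n]$, $X$ in degree $|X|-1$, with $\partial\{v_0<\dots<v_q\}=\sum_{p=0}^q(-1)^p\{v_0,\dots,\hat v_p,\dots,v_q\}$ for $q\geqslant1$ and $\partial=0$ in degree $0$. On the tensor product, $\partial(x\otimes y)=\partial x\otimes y+(-1)^{\deg x}x\otimes\partial y$. Higher Bruhat order. For $j\geqslant0$, $\mathcal{B}([0,n],j+1)$ is the set of consistent subsets $U\subseteq\binom{[0,n]}{j+2}$: for every $M=\{m_0<\dots<m_{j+2}\}\in\binom{[0,n]}{j+3}$, the set of $K\in U$ with $K\subset M$ is a beginning or an ending segment (possibly empty or everything) of $M\setminus m_{j+2}<\dots<M\setminus m_1<M\setminus m_0$. Covering relations: $U\lessdot V$ iff $V=U\cup\{K\}$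 for some $K\in\binom{[0,n]}{j+2}\setminus U$. Sign. For disjoint $L,A,B$ with union $S$, $\varepsilon_S(L,A,B)=\sum_{b\in B}|A|_{<b}+\sum_{l\in L}|L|_{<l}+|S|\,|A|\in\mathbb{Z}/2\mathbb{Z}$. The coproduct $\Delta_j^U$. For $U\in\mathcal{B}([0,n],j+1)$, non-empty $S\subseteq[0,n]$ and $L\in\binom{S}{j+1}$, let $A_L^{U,S}$ be the set of $a\in S\setminus L$ such that either $L\cup\{a\}\in U$ and $|L|_{>a}$ is even, or $L\cup\{a\}\notin U$ and $|L|_{>a}$ is odd; let $B_L^{U,S}=S\setminus(L\cup A_L^{U,S})$. Then, with $A=A_L^{U,S}$ and $B=B_L^{U,S}$, $\Delta_j^U(S)=\sum_{L\in\binom{S}{j+1}}(-1)^{\varepsilon_S(L,A,B)}(L\cup A)\otimes(L\cup B)$, extended linearly. Faces. With $\xi_t=(1,t,\dots,t^n)$, $Z([0,n],n+1)\subset\mathbb{R}^{n+1}$ is the Minkowski sum of the segments from $0$ to $\xi_0,\dots,\xi_n$. Its faces are $\sum_{a\in A}\xi_a+\sum_{l\in L}\overline{0\xi_l}$ for disjoint $L,A\subseteq[0,n]$; $L$ is called the set of generating vectors and $A$ the initial vertex; the dimension is $|L|$. An element $U\in\mathcal{B}([0,n],i)$ corresponds to the cubillage (union of $i$-dimensional faces) whose cubes are the faces with generating vectors $L'\in\binom{[0,n]}{i}$ and initial vertex $A_{L'}^{U,[0,n]}$. The face $F$ giving a covering relation $U\lessdot V=U\cup\{L\}$, $L\in\binom{[0,n]}{i+1}$,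 is the $(i+1)$-dimensional face whose lower facets belong to the cubillage of $U$ and whose upper facets belong to that of $V$; explicitly, its generating vectors are $L$ and its initial vertex is $A=A_{L\setminus l}^{U,[0,n]}\setminus\{l\}$, which is the same set for every $l\in L$. The coproduct $\Delta_i^F$. For a face $F$ with generating vectors $L$, $|L|=i+1$, initial vertex $A$, and $B=[0,n]\setminus(L\cup A)$, define for non-empty $S\subseteq[0,n]$: $\Delta_i^F(S)=(-1)^{\varepsilon_S(L,A\cap S,B\cap S)}(L\cup(A\cap S))\otimes(L\cup(B\cap S))$ if $L\subseteq S$, and $\Delta_i^F(S)=0$ otherwise; extend linearly. *)

(* Defs.v *)
From HB Require Import structures.
From mathcomp Require Import all_boot all_order all_algebra.

Set Implicit Arguments.
Unset Strict Implicit.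
Unset Printing Implicit Defensive.

Import GRing.Theory.
Local Open Scope ring_scope.

(* The vertex set [0,n] is 'I_n.+1. *)

Definition cardlt n (S : {set 'I_n.+1}) (x : 'I_n.+1) : nat :=
  #|[set s in S | (s < x)%N]|.

Definition cardgt n (S : {set 'I_n.+1}) (x : 'I_n.+1) : nat :=
  #|[set s in S | (x < s)%N]|.

(* Chains: C_*(Delta^n) is the total (ungraded) free Z-module on the non-empty
   subsets of [0,n], a subset X sitting in degree #|X|.-1.  Its tensor square is
   the free Z-module on pairs of non-empty subsets.  The scalar action of
   k : int is  c *~ k. *)

Definition simplex n := {X : {set 'I_n.+1} | X != set0}.

Definition chain n := {ffun simplex n -> int}.

Definition chain2 n := {ffun simplex n * simplex n -> int}.

(* The basis element of a non-empty set X; the junk value at set0 is 0. *)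
Definition basis n (X : {set 'I_n.+1}) : chain n :=
  [ffun s => (val s == X)%:R].

Definition tensor n (x y : chain n) : chain2 n :=
  [ffun p => x p.1 * y p.2].

Definition linext (T : finType) (M : zmodType) (f : T -> M)
    (c : {ffun T -> int}) : M :=
  \sum_(x : T) f x *~ c x.

(* A vertex v of X has position cardlt X v in the increasing listing of X. *)
Definition boundary_basis n (X : {set 'I_n.+1}) : chain n :=
  if (1 < #|X|)%N then \sum_(v in X) basis (X :\ v) *~ (-1) ^+ cardlt X v
  else 0.

Definition boundary n : chain n -> chain n :=
  linext (fun X : simplex n => boundary_basis (val X)).

Definition boundary2 n : chain2 n -> chain2 n :=
  linext (fun p : simplex n * simplex n =>
    tensor (boundary (basis (val p.1))) (basis (val p.2))
    + tensor (basis (val p.1)) (boundary (basis (val p.2)))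
        *~ (-1) ^+ #|val p.1|.-1).

(* The sets M :\ m, m in M, are ordered so that M :\ m precedes M :\ m' exactly
   when m' < m; a segment is a subset closed towards one end of this order. *)

Definition beginning_segment n (M : {set 'I_n.+1})
    (P : {set {set 'I_n.+1}}) : bool :=
  [forall m in M, forall m' in M,
     (m' < m)%N ==> (M :\ m' \in P) ==> (M :\ m \in P)].

Definition ending_segment n (M : {set 'I_n.+1})
    (P : {set {set 'I_n.+1}}) : bool :=
  [forall m in M, forall m' in M,
     (m' < m)%N ==> (M :\ m \in P) ==> (M :\ m' \in P)].

(* B([0,n],i), for i >= 1. *)
Definition higher_bruhat n (i : nat) : {set {set {set 'I_n.+1}}} :=
  [set U : {set {set 'I_n.+1}} |
     [forall K in U, #|K| == i.+1]
     && [forall M : {set 'I_n.+1}, (#|M| == i.+2) ==>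
          (let P := [set K in U | K \subset M] in
           beginning_segment M P || ending_segment M P)]].

Definition covers_by n (i : nat) (K : {set 'I_n.+1})
    (U V : {set {set 'I_n.+1}}) : Prop :=
  [/\ #|K| = i.+1, K \notin U & V = K |: U].

Definition setA n (U : {set {set 'I_n.+1}}) (S L : {set 'I_n.+1}) :
    {set 'I_n.+1} :=
  [set a in S :\: L |
     ((a |: L \in U) && ~~ odd (cardgt L a))
     || ((a |: L \notin U) && odd (cardgt L a))].

Definition setB n (U : {set {set 'I_n.+1}}) (S L : {set 'I_n.+1}) :
    {set 'I_n.+1} :=
  S :\: (L :|: setA U S L).

(* An integer exponent representing the sign in Z/2. *)
Definition eps n (S L A B : {set 'I_n.+1}) : nat :=
  (\sum_(b in B) cardlt A b + \sum_(l in L) cardlt L l + #|S| * #|A|)%N.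

Definition coprod_basis n (j : nat) (U : {set {set 'I_n.+1}})
    (S : {set 'I_n.+1}) : chain2 n :=
  \sum_(L : {set 'I_n.+1} | (L \subset S) && (#|L| == j.+1))
    tensor (basis (L :|: setA U S L)) (basis (L :|: setB U S L))
      *~ (-1) ^+ eps S L (setA U S L) (setB U S L).

Definition coprod n (j : nat) (U : {set {set 'I_n.+1}}) :
    chain n -> chain2 n :=
  linext (fun S : simplex n => coprod_basis j U (val S)).

(* A face of Z([0,n],n+1), recorded by its generating vectors and its initial
   vertex: the face is sum_(a in init) xi_a + sum_(l in gen) [0, xi_l]. *)
Record face n := Face {
  gen : {set 'I_n.+1};
  init : {set 'I_n.+1};
  face_disjoint : [disjoint gen & init]
}.

(* F is the face giving the covering relation U <. V in B([0,n],i).  The set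
   setA U setT (gen F :\ l) :\ l is the same for every l in gen F, so it is only
   required to be the initial vertex for some l. *)
Definition covering_face n (i : nat) (U V : {set {set 'I_n.+1}})
    (F : face n) : Prop :=
  covers_by i (gen F) U V /\
  exists2 l, l \in gen F & init F = setA U [set: 'I_n.+1] (gen F :\ l) :\ l.

(* The homotopy Delta_i^F; its index i is determined by F, as #|gen F| = i.+1. *)
Definition coprod_face_basis n (F : face n) (S : {set 'I_n.+1}) : chain2 n :=
  let L := gen F in
  let A := init F in
  let B := ~: (L :|: A) in
  if L \subset S then
    tensor (basis (L :|: (A :&: S))) (basis (L :|: (B :&: S)))
      *~ (-1) ^+ eps S L (A :&: S) (B :&: S)
  else 0.

Definition coprod_face n (F : face n) : chain n -> chain2 n :=
  linext (fun S : simplex n => coprod_face_basis F (val S)).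

(* Main.v *)
(* On a simplex S not containing the generating set L of F both sides vanish.
   If L is contained in S, the boundary of the single term of Delta_i^F(S) splits
   according to the vertex that is removed.  Removing a vertex of A or B gives the
   term of Delta_i^F on the corresponding facet of S, cancelling
   (-1)^i Delta_i^F(boundary S).  Removing l in L from the left, respectively the
   right, factor moves l to B, respectively to A; consistency of U and V shows that
   these are the terms of Delta_{i-1}^U and Delta_{i-1}^V indexed by L \ l, which
   of the two depending on the parity of |L|_{>l}.  All other terms of
   Delta_{i-1}^U and Delta_{i-1}^V coincide. *)

Require Import Defs.
From HB Require Import structures.
From mathcomp Require Import all_boot all_order all_algebra.
From mathcomp Require Import zify ring.
Import GRing.Theory.
Local Open Scope ring_scope.
Set Implicit Arguments.
Unset Strict Implicit.
Unset Printing Implicit Defensive.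

(** * Linear extensions and the boundary of an elementary tensor *)

Section Linearity.

Lemma linext_is_zmod_morphism (T : finType) (M : zmodType) (f : T -> M) :
  zmod_morphism (linext f).
Proof.
move=> c d; rewrite /linext -sumrB; apply: eq_bigr => x _.
by rewrite !ffunE mulrzBr.
Qed.

(** With this instance the generic lemmas on additive maps ([raddf_sum], [raddfMz], [raddf0]) apply
    to every operator defined by [linext]. *)
HB.instance Definition _ (T : finType) (M : zmodType) (f : T -> M) :=
  GRing.isZmodMorphism.Build {ffun T -> int} M (linext f)
    (linext_is_zmod_morphism f).

Lemma linext_delta (T : finType) (M : zmodType) (f : T -> M) (x : T) :
  linext f [ffun y => (y == x)%:R] = f x.
Proof.
rewrite /linext (bigD1 x) //= ffunE eqxx mulr1z big1 ?addr0 // => y /negPf yx.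
by rewrite ffunE yx mulr0z.
Qed.

Lemma linext_linext (T T' : finType) (M : zmodType) (f : T' -> M)
    (g : T -> {ffun T' -> int}) (c : {ffun T -> int}) :
  linext f (linext g c) = linext (linext f \o g) c.
Proof. by rewrite {2}/linext raddf_sum; apply: eq_bigr => x _; rewrite raddfMz. Qed.

Variable n : nat.
Implicit Types (X Y : {set 'I_n.+1}) (x y : chain n).

(** The condition on [X] provides an actual simplex: [basis set0] is zero, while [f set0] is
    arbitrary. *)
Lemma linext_basis (M : zmodType) (f : {set 'I_n.+1} -> M) X :
  X != set0 -> linext (fun s : simplex n => f (val s)) (basis X) = f X.
Proof.
move=> X0; have -> : basis X = [ffun s : simplex n => (s == exist _ X X0)%:R].
  by apply/ffunP => s; rewrite !ffunE -val_eqE.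
by rewrite linext_delta.
Qed.

Lemma linext_tensor_basis (M : zmodType)
    (f : {set 'I_n.+1} -> {set 'I_n.+1} -> M) X Y :
  X != set0 -> Y != set0 ->
  linext (fun p : simplex n * simplex n => f (val p.1) (val p.2))
    (tensor (basis X) (basis Y)) = f X Y.
Proof.
move=> X0 Y0.
have -> : tensor (basis X) (basis Y) = [ffun p : simplex n * simplex n =>
    (p == (exist _ X X0, exist _ Y Y0))%:R].
  apply/ffunP => -[s t]; rewrite !ffunE xpair_eqE -!val_eqE /=.
  by case: (_ == _); case: (_ == _).
by rewrite linext_delta.
Qed.

Lemma tensor_suml (I : finType) (P : pred I) (F : I -> chain n)
    (k : I -> int) y :
  tensor (\sum_(v | P v) F v *~ k v) y = \sum_(v | P v) tensor (F v) y *~ k v.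
Proof.
apply/ffunP => p; rewrite ffunE !sum_ffunE big_distrl /=.
by apply: eq_bigr => v _; rewrite !ffunMzE ffunE mulrzAl.
Qed.

Lemma tensor_sumr (I : finType) (P : pred I) (F : I -> chain n)
    (k : I -> int) x :
  tensor x (\sum_(v | P v) F v *~ k v) = \sum_(v | P v) tensor x (F v) *~ k v.
Proof.
apply/ffunP => p; rewrite ffunE !sum_ffunE big_distrr /=.
by apply: eq_bigr => v _; rewrite !ffunMzE ffunE mulrzAr.
Qed.

Lemma boundary2Mz (c : chain2 n) (k : int) :
  boundary2 (c *~ k) = boundary2 c *~ k.
Proof. by rewrite /boundary2 raddfMz. Qed.

Lemma boundary_basisE X : (1 < #|X|)%N ->
  boundary (basis X) = \sum_(v in X) basis (X :\ v) *~ (-1) ^+ cardlt X v.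
Proof.
move=> X1; rewrite /boundary linext_basis /boundary_basis ?X1 //.
by rewrite -card_gt0 ltnW.
Qed.

Lemma boundary2_tensor_basis X Y : (1 < #|X|)%N -> (1 < #|Y|)%N ->
  boundary2 (tensor (basis X) (basis Y)) =
    \sum_(v in X) tensor (basis (X :\ v)) (basis Y) *~ (-1) ^+ cardlt X v
    + \sum_(v in Y) tensor (basis X) (basis (Y :\ v))
        *~ (-1) ^+ (#|X|.-1 + cardlt Y v).
Proof.
move=> X1 Y1; rewrite /boundary2.
rewrite (linext_tensor_basis (fun X Y => tensor (boundary (basis X)) (basis Y)
    + tensor (basis X) (boundary (basis Y)) *~ (-1) ^+ #|X|.-1)); last first.
- by rewrite -card_gt0 ltnW.
- by rewrite -card_gt0 ltnW.
rewrite !boundary_basisE // tensor_suml tensor_sumr; congr (_ + _).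
by rewrite mulrz_suml; apply: eq_bigr => v _; rewrite -mulrzA exprD mulrC.
Qed.

End Linearity.

(** * Counting elements below and above a vertex *)

Section Counting.

Variable n : nat.
Implicit Types (S L A B : {set 'I_n.+1}) (a b l x : 'I_n.+1).

Lemma cardltU1 A a x : a \notin A ->
  cardlt (a |: A) x = ((a < x)%N + cardlt A x)%N.
Proof. by move=> aA; rewrite /cardlt -!sum1dep_card !big_mkcondr big_setU1. Qed.

Lemma cardgtU1 A a x : a \notin A ->
  cardgt (a |: A) x = ((x < a)%N + cardgt A x)%N.
Proof. by move=> aA; rewrite /cardgt -!sum1dep_card !big_mkcondr big_setU1. Qed.

Lemma big_setU_disjoint (M : nmodType) A B (F : 'I_n.+1 -> M) :
  [disjoint A & B] ->
  \sum_(x in A :|: B) F x = \sum_(x in A) F x + \sum_(x in B) F x.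
Proof.
by move=> AB; rewrite -bigU //; apply: eq_bigl => x; rewrite !inE.
Qed.

Lemma cardltU A B x : [disjoint A & B] ->
  cardlt (A :|: B) x = (cardlt A x + cardlt B x)%N.
Proof.
by move=> AB; rewrite /cardlt -!sum1dep_card !big_mkcondr big_setU_disjoint.
Qed.

Lemma card_cardlt_cardgt A x : x \notin A ->
  #|A| = (cardlt A x + cardgt A x)%N.
Proof.
move=> xA; rewrite /cardlt /cardgt -!sum1dep_card !big_mkcondr -big_split -sum1_card.
apply: eq_bigr => y yA; case: ltngtP => //= /val_inj yx.
by rewrite -yx yA in xA.
Qed.

Lemma setU1D1 A B x : x \notin A -> (A :|: B) :\ x = A :|: (B :\ x).
Proof.
by move=> /negPf xA; apply/setP=> y; rewrite !inE; case: eqP => // ->; rewrite xA.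
Qed.

Lemma setD1U A B x : x \in A -> (A :\ x) :|: (x |: B) = A :|: B.
Proof. by move=> xA; rewrite setUA setUC (setUC _ [set x]) setD1K // setUC. Qed.

Lemma card_pred_cardlt_cardgt L l : l \in L ->
  #|L|.-1 = (cardlt L l + cardgt L l)%N.
Proof.
move=> lL; have lL' : l \notin L :\ l by rewrite setD11.
rewrite (cardsD1 l) lL /= -{2 3}(setD1K lL) cardltU1 // cardgtU1 // ltnn.
exact: card_cardlt_cardgt.
Qed.

(** Each [b] above [a] gains one from the new element. *)
Lemma sum_cardltU1l A B a : a \notin A ->
  (\sum_(b in B) cardlt (a |: A) b = cardgt B a + \sum_(b in B) cardlt A b)%N.
Proof.
move=> aA; rewrite /cardgt -sum1dep_card big_mkcondr -big_split.
by apply: eq_bigr => b _; rewrite cardltU1 //=; case: (_ < _)%N.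
Qed.

Lemma sum_cardltD1l A B a : a \in A ->
  (\sum_(b in B) cardlt A b = cardgt B a + \sum_(b in B) cardlt (A :\ a) b)%N.
Proof. by move=> aA; rewrite -sum_cardltU1l ?setD11 ?setD1K. Qed.

(** The sum counts the two-element subsets of [L], of which [#|L|.-1] contain [l]. *)
Lemma sum_cardlt_selfD1 L l : l \in L ->
  (\sum_(k in L) cardlt L k = #|L|.-1 + \sum_(k in L :\ l) cardlt (L :\ l) k)%N.
Proof.
move=> lL; have lL' : l \notin L :\ l by rewrite setD11.
rewrite (cardsD1 l L) lL (big_setD1 l) //= (sum_cardltD1l _ lL) addnA.
rewrite -{1}(setD1K lL) cardltU1 // ltnn add0n /=.
by rewrite -card_cardlt_cardgt.
Qed.

(** The doubles [k + k] and [m + m] turn a congruence modulo 2 into an identity in [nat] within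
    reach of [ring]. *)
Lemma eq_signr (p q k m : nat) :
  (p + (k + k) = q + (m + m))%N -> (-1) ^+ p = (-1) ^+ q :> int.
Proof.
rewrite !addnn => /(congr1 odd); rewrite !oddD !odd_double !addbF => pq.
by rewrite -signr_odd pq signr_odd.
Qed.

End Counting.

(** * Signed terms of the coproducts and their boundary *)

Definition signed_tensor n (S L A B : {set 'I_n.+1}) : chain2 n :=
  tensor (basis (L :|: A)) (basis (L :|: B)) *~ (-1) ^+ eps S L A B.

Section BoundaryOfTerm.

Variables (n : nat) (L A B : {set 'I_n.+1}).
Hypotheses (dLA : [disjoint L & A]) (dLB : [disjoint L & B])
  (dAB : [disjoint A & B]).

Let S := L :|: A :|: B.

Lemma disjoint_LA_B : [disjoint L :|: A & B].
Proof. by rewrite -setI_eq0 setIUl setU_eq0 !setI_eq0 dLB. Qed.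

Lemma card_ground : #|S| = (#|L| + #|A| + #|B|)%N.
Proof.
by rewrite !cardsU (disjoint_setI0 disjoint_LA_B) (disjoint_setI0 dLA) !cards0 !subn0.
Qed.

Lemma cardlt_ground x : cardlt S x = (cardlt L x + cardlt A x + cardlt B x)%N.
Proof. by rewrite !cardltU ?disjoint_LA_B. Qed.

Lemma notin_disjoint (X Y : {set 'I_n.+1}) x :
  [disjoint X & Y] -> x \in X -> x \notin Y.
Proof. by move=> dXY xX; rewrite (disjointFr dXY). Qed.

(** The sum over [B] loses [cardgt B a]; the product [#|S| * #|A|] loses [#|S| + #|A|.-1]. *)
Lemma eps_delA a : a \in A ->
  eps S L A B = (eps (S :\ a) L (A :\ a) B + cardgt B a + #|S| + #|A|.-1)%N.
Proof.
move=> aA; have aS : a \in S by rewrite !inE aA orbT.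
rewrite /eps (sum_cardltD1l _ aA) (cardsD1 a S) aS (cardsD1 a A) aA /=.
by rewrite mulnDl !mulnDr; ring.
Qed.

Lemma eps_delB b : b \in B ->
  eps S L A B = (eps (S :\ b) L A (B :\ b) + cardlt A b + #|A|)%N.
Proof.
move=> bB; have bS : b \in S by rewrite !inE bB orbT.
rewrite /eps (big_setD1 b) //= (cardsD1 b S) bS /= mulnDl mul1n; ring.
Qed.

(** Leaving [L] costs [#|L|.-1] in the sum over [L]; entering [B] adds the summand [cardlt A l]. The
    loss is put on the left to avoid truncated subtraction. *)
Lemma eps_moveLB l : l \in L -> (eps S (L :\ l) A (l |: B) + #|L|.-1 =
  eps S L A B + cardlt A l)%N.
Proof.
move=> lL; rewrite /eps big_setU1 ?(notin_disjoint dLB lL) //=.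
rewrite (sum_cardlt_selfD1 lL); ring.
Qed.

(** Entering [A] adds [cardgt B l] to the sum over [B] and [#|S|] to the product. *)
Lemma eps_moveLA l : l \in L -> (eps S (L :\ l) (l |: A) B + #|L|.-1 =
  eps S L A B + cardgt B l + #|S|)%N.
Proof.
move=> lL; have lA := notin_disjoint dLA lL.
rewrite /eps sum_cardltU1l // (sum_cardlt_selfD1 lL) cardsU1 lA mulnDr muln1; ring.
Qed.

Lemma sign_face_Al a : L != set0 -> a \in A ->
  (-1) ^+ (eps S L A B + cardlt (L :|: A) a)
  = (-1) ^+ (eps (S :\ a) L (A :\ a) B + cardlt S a + #|L|.-1) :> int.
Proof.
rewrite -card_gt0 => L0 aA; rewrite (eps_delA aA) cardlt_ground cardltU //.
rewrite card_ground (card_cardlt_cardgt (notin_disjoint dAB aA)).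
rewrite -{1}(prednK L0) (cardsD1 a A) aA /=.
by apply: (@eq_signr _ _ 0 (cardgt B a + #|A :\ a|).+1); ring.
Qed.

Lemma sign_face_Br b : L != set0 -> b \in B ->
  (-1) ^+ (eps S L A B + (#|L :|: A|.-1 + cardlt (L :|: B) b))
  = (-1) ^+ (eps (S :\ b) L A (B :\ b) + cardlt S b + #|L|.-1) :> int.
Proof.
rewrite -card_gt0 => L0 bB; rewrite (eps_delB bB) cardlt_ground cardltU //.
rewrite cardsU (disjoint_setI0 dLA) cards0 subn0 -{1}(prednK L0) addSn /=.
by apply: (@eq_signr _ _ 0 #|A|); ring.
Qed.

Lemma sign_face_Ll l : l \in L ->
  (-1) ^+ (eps S L A B + cardlt (L :|: A) l)
  = (-1) ^+ (eps S (L :\ l) A (l |: B) + cardgt L l) :> int.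
Proof.
move=> lL; have := eps_moveLB lL.
rewrite (card_pred_cardlt_cardgt lL) cardltU // => e.
apply: (@eq_signr _ _ 0 (cardlt L l)).
have -> : (eps S L A B + (cardlt L l + cardlt A l) + (0 + 0) =
  eps S L A B + cardlt A l + cardlt L l)%N by ring.
by rewrite -e; ring.
Qed.

(** Removal from the right factor carries the Koszul sign. Modulo 2 all counts cancel except the
    [-1] in the degree [#|L :|: A|.-1], which gives the minus sign. *)
Lemma sign_face_Lr l : l \in L ->
  (-1) ^+ (eps S L A B + (#|L :|: A|.-1 + cardlt (L :|: B) l))
  = - (-1) ^+ (eps S (L :\ l) (l |: A) B + cardgt L l) :> int.
Proof.
move=> lL; have := eps_moveLA lL.
have L0 : (0 < #|L|)%N by rewrite (cardsD1 l) lL.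
rewrite card_ground cardsU (disjoint_setI0 dLA) cards0 subn0.
rewrite -(prednK L0) addSn /= (card_pred_cardlt_cardgt lL) cardltU //.
rewrite (card_cardlt_cardgt (notin_disjoint dLB lL)) => e.
rewrite -[RHS]mulN1r -exprS.
apply: (@eq_signr _ _ (cardgt B l).+1 (cardlt L l)).
set E := (_ + cardgt L l).+1.
transitivity (eps S (L :\ l) (l |: A) B + (cardlt L l + cardgt L l)
   + (1 + cardlt L l))%N; last by rewrite /E; ring.
by rewrite e; ring.
Qed.

(** The two factors share exactly [L]: a vertex of [A] is removed only from the left, one of [B]
    only from the right, one of [L] from either. The bound on [#|L|] keeps both factors out of
    degree 0. *)
Lemma boundary2_signed_tensor : (1 < #|L|)%N ->
  boundary2 (signed_tensor S L A B) =
    (\sum_(a in A) signed_tensor (S :\ a) L (A :\ a) B *~ (-1) ^+ cardlt S a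
     + \sum_(b in B) signed_tensor (S :\ b) L A (B :\ b) *~ (-1) ^+ cardlt S b)
      *~ (-1) ^+ #|L|.-1
    + \sum_(l in L) (signed_tensor S (L :\ l) A (l |: B)
                     - signed_tensor S (L :\ l) (l |: A) B)
      *~ (-1) ^+ cardgt L l.
Proof.
move=> L1; have L0 : L != set0 by rewrite -card_gt0 ltnW.
have gt1U X : (1 < #|L :|: X|)%N.
  by apply: leq_trans L1 _; rewrite subset_leq_card ?subsetUl.
rewrite {1}/signed_tensor boundary2Mz boundary2_tensor_basis // !big_setU_disjoint //.
(* Group the two sums over [L] together, apart from those over [A] and [B]. *)
rewrite addrACA [X in X *~ _ = _]addrC !mulrzDl.
congr (_ + _ + _).
- rewrite [LHS]mulrz_suml [RHS]mulrz_suml; apply: eq_bigr => v vA.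
  rewrite /signed_tensor -!mulrzA -!exprD addnC sign_face_Al // ?addnA.
  by rewrite setU1D1 // (notin_disjoint _ vA) // disjoint_sym.
- rewrite [LHS]mulrz_suml [RHS]mulrz_suml; apply: eq_bigr => v vB.
  rewrite /signed_tensor -!mulrzA -!exprD addnC sign_face_Br // ?addnA.
  by rewrite setU1D1 ?(notin_disjoint _ vB) 1?disjoint_sym.
rewrite -mulrzDl -big_split [LHS]mulrz_suml; apply: eq_bigr => v vL.
have [vA vB] := (notin_disjoint dLA vL, notin_disjoint dLB vL).
rewrite /= mulrzDl mulrzBl /signed_tensor.
(* The factor that keeps [v] is unchanged as a set: [v] merely passes from [L] to [A] or [B], by
   [setD1U]. *)
rewrite (setUC L A) (setUC L B) !setU1D1 // (setUC A (L :\ v)) (setUC B (L :\ v)).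
rewrite !setD1U // (setUC A L) (setUC B L) -4!mulrzA -!exprD.
congr (_ + _); first by rewrite addnC sign_face_Ll.
by rewrite addnC sign_face_Lr ?mulrNz.
Qed.

End BoundaryOfTerm.

(** * Initial vertices along a covering relation *)

Section InitialVertex.

Variables (n i : nat) (U V : {set {set 'I_n.+1}}) (L : {set 'I_n.+1}).
Hypotheses (hU : U \in higher_bruhat n i) (hV : V \in higher_bruhat n i)
  (hL : covers_by i L U V).

Lemma higher_bruhat_segment (W : {set {set 'I_n.+1}}) (M : {set 'I_n.+1}) :
  W \in higher_bruhat n i -> #|M| = i.+2 ->
  {in M &, forall m m' : 'I_n.+1, (m' < m)%N ==> (M :\ m' \in W) ==> (M :\ m \in W)} \/
  {in M &, forall m m' : 'I_n.+1, (m' < m)%N ==> (M :\ m \in W) ==> (M :\ m' \in W)}.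
Proof.
have inW m : (M :\ m \in [set K in W | K \subset M]) = (M :\ m \in W).
  by rewrite inE subsetDl andbT.
rewrite inE => /andP[_ /forallP/(_ M)] /implyP + /eqP cM => /(_ cM).
case/orP => /forall_inP seg; [left|right] => m m' mM m'M;
  by have /forall_inP/(_ m' m'M) := seg m mM; rewrite !inW.
Qed.

Lemma in_setA (W : {set {set 'I_n.+1}}) (S K : {set 'I_n.+1}) a :
  a \in setA W S K =
  [&& a \in S, a \notin K & (a |: K \in W) (+) odd (cardgt K a)].
Proof.
rewrite !inE andbCA andbA; congr (_ && _).
by case: (_ \in W); case: odd.
Qed.

(* Consistency of [U] and of [V = L |: U] at [M = a |: L], where [L = M :\ a],
   forces [M :\ l \in U] to hold for [l] on one side of [a] and to fail on the
   other.  This is why the initial vertex of the face is independent of [l]. *)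
Lemma facet_side a l l' : a \notin L -> l \in L -> l' \in L ->
  ((a |: L) :\ l \in U) (+) (a < l)%N = ((a |: L) :\ l' \in U) (+) (a < l')%N.
Proof.
move=> aL lL l'L; have [cL LU VE] := hL.
set M := a |: L.
have cM : #|M| = i.+2 by rewrite cardsU1 aL cL.
have aM : a \in M by rewrite setU11.
have LM m : m \in L -> m \in M by move=> mL; rewrite setU1r.
have Ma : M :\ a = L by rewrite setU1K.
have inV m : m \in L -> (M :\ m \in V) = (M :\ m \in U).
  move=> mL; rewrite VE in_setU1; case: eqP => // ML.
  by have := setD11 m M; rewrite ML mL.
have Ua : (M :\ a \in U) = false by rewrite Ma; apply/negbTE.
have Va : M :\ a \in V by rewrite Ma VE setU11.
have neq m : m \in L -> (m : nat) != a.
  by move=> mL; apply: contraNneq aL => /val_inj <-.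
have [-> //|nll'] := eqVneq l l'.
have {}nll' : (l : nat) != l' by [].
have [nla nl'a] := (neq l lL, neq l' l'L); have [lM l'M] := (LM l lL, LM l' l'L).
(* For each pair of segment types, only the order of [a], [l], [l'] and two booleans remain after
   abstraction; [lia] discards the impossible orders. *)
have [sU|sU] := higher_bruhat_segment hU cM;
have [sV|sV] := higher_bruhat_segment hV cM;
  move: (sU l a lM aM) (sU a l aM lM) (sU l' a l'M aM) (sU a l' aM l'M)
        (sU l l' lM l'M) (sU l' l l'M lM)
        (sV l a lM aM) (sV a l aM lM) (sV l' a l'M aM) (sV a l' aM l'M)
        (sV l l' lM l'M) (sV l' l l'M lM);
  rewrite Ua Va !(inV l) ?(inV l') //;
  move: nla nl'a nll';
  move: (M :\ l \in U) (M :\ l' \in U) (a : nat) (l : nat) (l' : nat);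
  clear => u u' {}a {}l {}l';
  case: (ltngtP a l) => // al _; case: (ltngtP a l') => // al' _;
  case: (ltngtP l l') => // ll' _; try (exfalso; lia);
  by case: u; case: u'.
Qed.

(** Replacing [cardgt (L :\ l) a] by [cardgt L a] costs the bit [a < l], so all dependence on [l]
    sits in the expression treated by [facet_side]. *)
Lemma mem_setA_facet (S : {set 'I_n.+1}) a l : a \in S -> a \notin L -> l \in L ->
  (a \in setA U S (L :\ l)) =
  ((a |: L) :\ l \in U) (+) (a < l)%N (+) odd (cardgt L a).
Proof.
move=> aS aL lL; rewrite in_setA aS !inE (negPf aL) andbF /=.
have nla : l != a by apply: contraNneq aL => <-.
have -> : a |: L :\ l = (a |: L) :\ l by rewrite setU1D1 // inE.
have lL' : l \notin L :\ l by rewrite setD11.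
rewrite -[in cardgt L a](setD1K lL) cardgtU1 // oddD.
by case: (_ \in U); case: (a < l)%N; case: odd.
Qed.

(** Elements of [L] lie in neither side; for the others [facet_side] removes the dependence on
    [l]. *)
Lemma setA_facet_init (S : {set 'I_n.+1}) l l0 : L \subset S ->
  l \in L -> l0 \in L ->
  setA U S (L :\ l) :\ l =
    (setA U setT (L :\ l0) :\ l0) :&: S.
Proof.
move=> LS lL l0L; apply/setP=> a.
have [aL|aL] := boolP (a \in L).
  by rewrite !in_setD1 in_setI in_setD1 !in_setA !in_setD1 aL !andbT;
     case: (a == l); case: (a == l0); rewrite ?andbF.
have nal k : k \in L -> a != k by move=> kL; apply: contraNneq aL => ->.
rewrite in_setI !in_setD1 !nal //=.
have [aS|aS] := boolP (a \in S); last by rewrite in_setA (negPf aS) andbF.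
by rewrite !mem_setA_facet // ?inE // (facet_side aL lL l0L) andbT.
Qed.

(** For [a] other than [l], the set [a |: L :\ l] misses [l], so it is not [L], the only set on
    which [U] and [V] differ. *)
Lemma setA_cover_facet (S : {set 'I_n.+1}) l : l \in L ->
  setA V S (L :\ l) :\ l = setA U S (L :\ l) :\ l.
Proof.
move=> lL; have [_ _ ->] := hL; apply/setP=> a; rewrite !in_setD1 !in_setA.
case: eqVneq => //= nal; congr [&& _, _ & _ (+) _]; rewrite in_setU1.
case: eqP => // /setP/(_ l); rewrite !inE eqxx lL andFb orbF eq_sym.
by rewrite (negPf nal).
Qed.

(** A difference at [a] in [S] would require [a |: K = L], hence [K \subset L] and [L \subset S]. *)
Lemma setA_cover_notfacet (S K : {set 'I_n.+1}) : K \subset S ->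
  ~~ ((K \subset L) && (L \subset S)) -> setA V S K = setA U S K.
Proof.
move=> KS KL; have [_ _ ->] := hL; apply/setP=> a; rewrite !in_setA in_setU1.
have [aS|//] := boolP (a \in S); case: eqP => // aK.
by rewrite -aK subsetUr subUset sub1set aS KS in KL.
Qed.

Lemma mem_setA_removed (S : {set 'I_n.+1}) l : L \subset S -> l \in L ->
  (l \in setA U S (L :\ l)) = odd (cardgt L l) /\
  (l \in setA V S (L :\ l)) = ~~ odd (cardgt L l).
Proof.
move=> LS lL; have [_ LU ->] := hL.
have lL' : l \notin L :\ l by rewrite setD11.
rewrite !in_setA (subsetP LS l lL) lL' setD1K // setU11 (negPf LU) /=.
by rewrite -[in cardgt L l](setD1K lL) cardgtU1 // ltnn.
Qed.

(** Only the indices [L :\ l] survive in the difference. There [U] and [V] share the initial vertex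
    [A] up to [l], which they put on opposite sides. *)
Lemma coprod_cover_diff (S A : {set 'I_n.+1}) (l0 : 'I_n.+1) : (0 < i)%N ->
  L \subset S -> l0 \in L -> A = (setA U setT (L :\ l0) :\ l0) :&: S ->
  coprod_basis i.-1 U S - coprod_basis i.-1 V S =
  \sum_(l in L) (signed_tensor S (L :\ l) A (l |: (S :\: (L :|: A)))
                 - signed_tensor S (L :\ l) (l |: A) (S :\: (L :|: A)))
      *~ (-1) ^+ cardgt L l.
Proof.
move=> i0 LS l0L AE; rewrite /coprod_basis prednK // -sumrB.
have [cL _ _] := hL.
have cLl l : l \in L -> #|L :\ l| = i.
  by move=> lL; have := cardsD1 l L; rewrite cL lL => -[].
rewrite (bigID (fun K : {set 'I_n.+1} => K \subset L)) /= addrC big1 ?add0r; last first.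
  move=> K /andP[/andP[KS _] KL].
  by rewrite /setB setA_cover_notfacet ?(negPf KL) // subrr.
(* The subsets of [L] with [i] elements are exactly the [L :\ l]. *)
rewrite (eq_bigl (fun K => K \in [set L :\ l | l in L])); last first.
  move=> K; apply/andP/imsetP => [[/andP[KS /eqP cK] KL]|[l lL ->]].
    have /cards1P[l lE] : #|L :\: K| == 1%N
      by rewrite cardsD (setIidPr KL) cL cK subSnn.
    exists l; first by have := set11 l; rewrite -lE inE => /andP[].
    by rewrite -lE setDDr setDv set0U (setIidPr KL).
  by rewrite cLl // eqxx subsetDl (subset_trans (subsetDl _ _) LS).
rewrite big_imset /=; last first.
  move=> l l' lL l'L /setP/(_ l); rewrite !inE eqxx lL andbT /=.
  by case: eqP.
apply: eq_bigr => l lL.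
have [lU lV] := mem_setA_removed LS lL.
have AU : setA U S (L :\ l) :\ l = A by rewrite AE (setA_facet_init LS lL l0L).
have AV : setA V S (L :\ l) :\ l = A by rewrite setA_cover_facet.
have lA : l \notin A by rewrite -AU setD11.
have lS := subsetP LS l lL.
have BE : S :\: (L :\ l :|: A) = l |: (S :\: (L :|: A)).
  apply/setP=> x; rewrite !inE; case: eqVneq => //= ->.
  by rewrite (negPf lA) lS.
have BE' : S :\: (L :\ l :|: (l |: A)) = S :\: (L :|: A).
  by rewrite setD1U.
have setAE W : setA W S (L :\ l) :\ l = A ->
    setA W S (L :\ l) = if l \in setA W S (L :\ l) then l |: A else A.
  move=> <-; case: ifP => [/setD1K-> //|lW].
  by apply/setP=> x; rewrite in_setD1; case: eqP => // ->.
rewrite /setB (setAE U AU) (setAE V AV) lU lV -[in RHS](signr_odd _ (cardgt L l)).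
(* In the odd case [U] puts [l] in [A] and [V] puts it in [B], which reverses the difference; the
   even case is the opposite. *)
case: odd; rewrite /= ?BE ?BE' /signed_tensor.
  by rewrite expr1 mulrN1z opprB.
by rewrite expr0 mulr1z.
Qed.

End InitialVertex.

(** * Evaluation on simplices and extension to chains *)

Lemma coprod_face_boundary_basis n (F : face n) (S : {set 'I_n.+1}) :
  (1 < #|S|)%N ->
  coprod_face F (boundary_basis S) =
  \sum_(v in S) coprod_face_basis F (S :\ v) *~ (-1) ^+ cardlt S v.
Proof.
move=> S1; rewrite /boundary_basis S1 /coprod_face raddf_sum.
apply: eq_bigr => v vS.
rewrite raddfMz [X in X *~ _](linext_basis (coprod_face_basis F)) //.
by rewrite -card_gt0; move: S1; rewrite (cardsD1 v) vS.
Qed.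

Lemma homotopy_on_simplex (n i : nat) (U V : {set {set 'I_n.+1}}) (F : face n)
    (S : {set 'I_n.+1}) :
  (1 <= i)%N -> U \in higher_bruhat n i -> V \in higher_bruhat n i ->
  covering_face i U V F ->
  boundary2 (coprod_face_basis F S) - coprod_face F (boundary_basis S) *~ (-1) ^+ i
    = coprod_basis i.-1 U S - coprod_basis i.-1 V S.
Proof.
move=> hi hU hV [hL [l0 l0L initE]]; have [cL _ _] := hL.
set L := gen F in hL l0L initE cL *; set A := init F in initE *.
have [LS|LS] := boolP (L \subset S); last first.
  have -> : coprod_face_basis F S = 0 by rewrite /coprod_face_basis (negPf LS).
  have -> : coprod_face F (boundary_basis S) = 0.
    (* With at most one vertex, [boundary_basis S] is zero by definition. *)
    have [S1|S1] := boolP (1 < #|S|)%N; last first.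
      by rewrite /boundary_basis (negPf S1) /coprod_face raddf0.
    rewrite coprod_face_boundary_basis // big1 // => v vS.
    rewrite /coprod_face_basis ifN ?mul0rz //; apply: contra LS => LSv.
    exact: subset_trans LSv (subsetDl _ _).
  rewrite /boundary2 raddf0 mul0rz subrr; apply/esym/eqP; rewrite subr_eq0.
  apply/eqP/eq_bigr => K /andP[KS _].
  by rewrite /setB (setA_cover_notfacet hL) // (negPf LS) andbF.
have S1 : (1 < #|S|)%N by rewrite (leq_trans _ (subset_leq_card LS)) // cL.
set A' := A :&: S; set B' := ~: (L :|: A) :&: S.
have dLA : [disjoint L & A'].
  by rewrite (disjointWr (subsetIl _ _)) // (face_disjoint F).
have dLB : [disjoint L & B'].
  rewrite (disjointWr (subsetIl _ _)) // disjoints_subset setCK.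
  exact: subsetUl.
have dAB : [disjoint A' & B'].
  rewrite (disjointW (subsetIl _ _) (subsetIl _ _)) //.
  by rewrite disjoints_subset setCK subsetUr.
have SE : S = L :|: A' :|: B'.
  apply/setP=> x; rewrite !inE; have := subsetP LS x.
  by case: (x \in L) => [->|_] //; case: (x \in A); case: (x \in S).
have BE : B' = S :\: (L :|: A').
  apply/setP=> x; rewrite !inE.
  by case: (x \in L); case: (x \in A); case: (x \in S).
have faceE (T : {set 'I_n.+1}) : L \subset T ->
    coprod_face_basis F T = signed_tensor T L (A :&: T) (~: (L :|: A) :&: T).
  by move=> LT; rewrite /coprod_face_basis LT.
rewrite faceE // coprod_face_boundary_basis //.
rewrite (coprod_cover_diff hU hV hL hi LS l0L (A := A')); last by rewrite -initE.
rewrite -BE {1}SE boundary2_signed_tensor // ?cL // -SE.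
(* The sum over [L] is already the right-hand side; the sums over [A'] and [B'] must cancel the face
   coproduct of the boundary. *)
rewrite addrAC -[RHS]add0r; congr (_ + _); apply/eqP; rewrite subr_eq0; apply/eqP.
(* The signs agree because [#|L|.-1] is [i]. *)
congr (_ *~ _).
rewrite [RHS](eq_bigl (fun v => v \in L :|: (A' :|: B'))); last first.
  by move=> v; rewrite {1}SE setUA.
rewrite big_setU_disjoint; last first.
  by rewrite disjoint_sym -setI_eq0 setIUl setU_eq0 !setI_eq0 !(disjoint_sym _ L)
             dLA dLB.
(* Removing a vertex of [L] leaves a simplex not containing [L], where the face coproduct is
   zero. *)
rewrite [X in _ = X + _]big1 ?add0r; last first.
  by move=> v vL; rewrite /coprod_face_basis subsetD1 vL andbF mul0rz.
have LSv v : v \notin L -> L \subset S :\ v by rewrite subsetD1 LS.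
rewrite big_setU_disjoint //; congr (_ + _); apply: eq_bigr => v vX;
  congr (_ *~ _).
  have vL : v \notin L by rewrite (notin_disjoint _ vX) // disjoint_sym.
  have vB := notin_disjoint dAB vX.
  rewrite faceE; last exact: LSv.
  rewrite 2!setIDA; congr (signed_tensor _ _ _ _).
  by apply/setP=> x; rewrite in_setD1; case: eqP => // ->; rewrite (negPf vB).
have vL : v \notin L by rewrite (notin_disjoint _ vX) // disjoint_sym.
have vA : v \notin A' by rewrite (notin_disjoint _ vX) // disjoint_sym.
rewrite faceE; last exact: LSv.
rewrite 2!setIDA; congr (signed_tensor _ _ _ _).
by apply/setP=> x; rewrite in_setD1; case: eqP => // ->; rewrite (negPf vA).
Qed.

Theorem theorem3p13 (n i : nat) (U V : {set {set 'I_n.+1}}) (F : face n)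
    (hi : (1 <= i)%N)
    (hU : U \in higher_bruhat n i) (hV : V \in higher_bruhat n i)
    (hF : covering_face i U V F) :
  forall c : chain n,
    boundary2 (coprod_face F c) - coprod_face F (boundary c) *~ (-1) ^+ i
    = coprod i.-1 U c - coprod i.-1 V c.
Proof.
(* Both sides become sums over simplices weighted by [c], compared term by term. *)
move=> c; rewrite /boundary2 /coprod_face /boundary !linext_linext.
rewrite /coprod /linext -sumrB mulrz_suml -sumrB.
apply: eq_bigr => -[S S0] _; rewrite mulrzAC -!mulrzBl; congr (_ *~ _).
exact: homotopy_on_simplex.
Qed.
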